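(* Let $R$ be a commutative Noetherian ring with unity, $\lambda$ a length function on $R$-modules, $S=R[x_1,\dots,x_k]$ and $I=(x_1,\dots,x_k)\subseteq S$. Let $M$ be a finitely generated $S$-module with $\lambda(M/IM)<\infty$, and put $c_n=\lambda(M/I^{n+1}M)$. Then every $c_n$ is finite, and there exists a polynomial $\bar q(t)\in\mathbb{R}[t]$ of degree at most $k$ such that $c_n=\bar q(n)$ for all sufficiently large $n\in\mathbb{N}$.
   Context: A length function on $R$-modules is a function $\lambda$ from $R$-modules to $\mathbb{R}_{\ge0}\cup\{\infty\}$ with $\lambda(0)=0$, invariant under isomorphism, additive on short exact sequences, and with $\lambda(N)=\sup\{\lambda(N'):N'\le N$ finitely generated$\}$. *)

(* Defs.v *)
From HB Require Import structures.
From mathcomp Require Import all_boot all_order all_algebra.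
From mathcomp Require Import mpoly.
From mathcomp Require Import boolp classical_sets constructive_ereal ereal Rstruct.
From Stdlib Require Import ClassicalEpsilon ProofIrrelevance.
From Stdlib Require List.

Set Implicit Arguments.
Unset Strict Implicit.
Unset Printing Implicit Defensive.

Import GRing.Theory Num.Theory.
Local Open Scope ring_scope.

(* Left modules over a ring A, as a record (so that one can quantify   *)
(* over "all A-modules" and form submodules and quotients).            *)

Record module (A : nzRingType) := Module {
  mcarrier :> Type;
  mzero : mcarrier;
  madd : mcarrier -> mcarrier -> mcarrier;
  mopp : mcarrier -> mcarrier;
  mscale : A -> mcarrier -> mcarrier;
  maddA : forall x y z, madd x (madd y z) = madd (madd x y) z;
  maddC : forall x y, madd x y = madd y x;
  madd0 : forall x, madd mzero x = x;
  maddN : forall x, madd (mopp x) x = mzero;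
  mscaleA : forall a b x, mscale a (mscale b x) = mscale (a * b) x;
  mscale1 : forall x, mscale 1 x = x;
  mscaleDr : forall a x y, mscale a (madd x y) = madd (mscale a x) (mscale a y);
  mscaleDl : forall a b x, mscale (a + b) x = madd (mscale a x) (mscale b x)
}.

Arguments mzero {A M} : rename.
Arguments madd {A M} : rename.
Arguments mopp {A M} : rename.
Arguments mscale {A M} : rename.

Section ModuleTheory.
Variables (A : nzRingType) (M : module A).
Implicit Types (x y z : M).

Lemma maddr0 x : madd x mzero = x.
Proof. by rewrite maddC madd0. Qed.

Lemma maddNr x : madd x (mopp x) = mzero.
Proof. by rewrite maddC maddN. Qed.

Lemma madd_cancel x y z : madd x y = madd x z -> y = z.
Proof.
move=> e; rewrite -(madd0 y) -(madd0 z) -(maddN x) -!maddA; by rewrite e.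
Qed.

Lemma mscale0 x : mscale 0 x = mzero.
Proof.
apply: (@madd_cancel (mscale 0 x)); rewrite -mscaleDl addr0; by rewrite maddr0.
Qed.

Lemma mscaleN1 x : mscale (-1) x = mopp x.
Proof.
apply: (@madd_cancel x); rewrite maddNr -{1}(mscale1 x) -mscaleDl.
by rewrite subrr mscale0.
Qed.

Lemma moppD x y : mopp (madd x y) = madd (mopp x) (mopp y).
Proof. by rewrite -!mscaleN1 mscaleDr. Qed.

Lemma moppK x : mopp (mopp x) = x.
Proof. by rewrite -!mscaleN1 mscaleA mulrNN mulr1 mscale1. Qed.

Lemma mscaleN a x : mscale a (mopp x) = mopp (mscale a x).
Proof. by rewrite -!mscaleN1 !mscaleA mulrN1 mulN1r. Qed.

Lemma madd4 x y z w :
  madd (madd x y) (madd z w) = madd (madd x z) (madd y w).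
Proof.
by rewrite -!maddA; congr madd; rewrite !maddA; congr madd; rewrite maddC.
Qed.

Lemma msubD x y x' y' :
  madd (madd x y) (mopp (madd x' y')) = madd (madd x (mopp x')) (madd y (mopp y')).
Proof. by rewrite moppD madd4. Qed.

Lemma msubK x z w : madd (madd z (mopp x)) (madd x w) = madd z w.
Proof. by rewrite -maddA [madd (mopp x) _]maddA maddN madd0. Qed.

End ModuleTheory.

Definition msum (A : nzRingType) (M : module A) (l : seq M) : M :=
  foldr madd mzero l.

Definition is_linear (A : nzRingType) (M N : module A) (f : M -> N) : Prop :=
  (forall x y, f (madd x y) = madd (f x) (f y)) /\
  (forall a x, f (mscale a x) = mscale a (f x)).

Definition isomorphic (A : nzRingType) (M N : module A) : Prop :=
  exists f : M -> N, is_linear f /\ bijective f.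

Definition short_exact (A : nzRingType) (M1 M2 M3 : module A) : Prop :=
  exists (f : M1 -> M2) (g : M2 -> M3),
    [/\ is_linear f, is_linear g, injective f, (forall z, exists y, g y = z) &
        forall y, (exists x, f x = y) <-> g y = mzero].

Definition is_submodule (A : nzRingType) (M : module A) (P : M -> Prop) : Prop :=
  [/\ P mzero,
      (forall x y, P x -> P y -> P (madd x y)) &
      (forall a x, P x -> P (mscale a x))].

Definition mspan (A : nzRingType) (M : module A) (G : M -> Prop) : M -> Prop :=
  fun x => exists l : seq (A * M),
    (forall p, List.In p l -> G p.2) /\
    x = msum [seq mscale p.1 p.2 | p <- l].

Definition fg_module (A : nzRingType) (M : module A) : Prop :=
  exists gens : seq M, forall x, mspan (fun y => List.In y gens) x.

Section Submodule.
Variables (A : nzRingType) (M : module A) (P : M -> Prop).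
Hypothesis HP : is_submodule P.

Lemma sub_eq (u v : {x : M | P x}) : proj1_sig u = proj1_sig v -> u = v.
Proof.
case: u => x px; case: v => y py /= e; subst y; by rewrite (proof_irrelevance _ px py).
Qed.

Lemma subP_opp x : P x -> P (mopp x).
Proof. by case: HP => _ _ hs px; rewrite -mscaleN1; apply: hs. Qed.

Definition sub_zero : {x : M | P x} :=
  exist _ mzero (let: And3 h _ _ := HP in h).
Definition sub_add (u v : {x : M | P x}) : {x : M | P x} :=
  exist _ (madd (proj1_sig u) (proj1_sig v))
    (let: And3 _ h _ := HP in h _ _ (proj2_sig u) (proj2_sig v)).
Definition sub_opp (u : {x : M | P x}) : {x : M | P x} :=
  exist _ (mopp (proj1_sig u)) (subP_opp (proj2_sig u)).
Definition sub_scale (a : A) (u : {x : M | P x}) : {x : M | P x} :=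
  exist _ (mscale a (proj1_sig u))
    (let: And3 _ _ h := HP in h a _ (proj2_sig u)).

Definition submodule : module A.
Proof.
refine (@Module A {x : M | P x} sub_zero sub_add sub_opp sub_scale
          _ _ _ _ _ _ _ _);
  intros; apply: sub_eq => /=.
- exact: maddA.
- exact: maddC.
- exact: madd0.
- exact: maddN.
- exact: mscaleA.
- exact: mscale1.
- exact: mscaleDr.
- exact: mscaleDl.
Defined.
End Submodule.

Section Quotient.
Variables (A : nzRingType) (M : module A) (P : M -> Prop).
Hypothesis HP : is_submodule P.

Let Padd x y : P x -> P y -> P (madd x y).
Proof. by case: HP => _ h _; apply: h. Qed.
Let Pscale a x : P x -> P (mscale a x).
Proof. by case: HP => _ _ h; apply: h. Qed.
Let P0 : P mzero.
Proof. by case: HP. Qed.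

(* canonical representative of the coset of x *)
Definition qnf (x : M) : M :=
  epsilon (inhabits mzero) (fun y => P (madd y (mopp x))).

Lemma qnf_spec x : P (madd (qnf x) (mopp x)).
Proof.
rewrite /qnf; apply: (epsilon_spec (inhabits mzero) (fun y => P (madd y (mopp x)))).
by exists x; rewrite maddNr.
Qed.

Lemma qnf_eq x y : P (madd x (mopp y)) -> qnf x = qnf y.
Proof.
move=> pxy; rewrite /qnf; congr epsilon.
apply: functional_extensionality_dep => z.
apply: propositional_extensionality; split => h.
- by have := Padd h pxy; rewrite msubK.
- have := Padd h (subP_opp HP pxy).
  by rewrite moppD moppK [madd (mopp x) y]maddC msubK.
Qed.

Lemma qnf_idem x : qnf (qnf x) = qnf x.
Proof. exact/qnf_eq/qnf_spec. Qed.

Lemma qnf_addl x y : qnf (madd (qnf x) y) = qnf (madd x y).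
Proof. by apply: qnf_eq; rewrite msubD maddNr maddr0; apply: qnf_spec. Qed.

Lemma qnf_addr x y : qnf (madd x (qnf y)) = qnf (madd x y).
Proof. by rewrite maddC qnf_addl maddC. Qed.

Lemma qnf_opp x : qnf (mopp (qnf x)) = qnf (mopp x).
Proof.
apply: qnf_eq; rewrite -moppD; apply: (subP_opp HP); exact: qnf_spec.
Qed.

Lemma qnf_scale a x : qnf (mscale a (qnf x)) = qnf (mscale a x).
Proof.
by apply: qnf_eq; rewrite -mscaleN -mscaleDr; apply: Pscale; apply: qnf_spec.
Qed.

Definition qtype := {x : M | qnf x = x}.

Definition qmk (x : M) : qtype := exist _ (qnf x) (qnf_idem x).

Lemma q_eq (u v : qtype) : proj1_sig u = proj1_sig v -> u = v.
Proof.
case: u => x px; case: v => y py /= e; subst y; by rewrite (proof_irrelevance _ px py).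
Qed.

Definition quotient : module A.
Proof.
refine (@Module A qtype (qmk mzero)
          (fun u v => qmk (madd (proj1_sig u) (proj1_sig v)))
          (fun u => qmk (mopp (proj1_sig u)))
          (fun a u => qmk (mscale a (proj1_sig u)))
          _ _ _ _ _ _ _ _);
  intros; apply: q_eq => /=.
- by rewrite qnf_addl qnf_addr maddA.
- by rewrite maddC.
- case: x => x px /=; by rewrite qnf_addl madd0.
- case: x => x px /=; by rewrite qnf_addl maddN.
- by rewrite qnf_scale mscaleA.
- case: x => x px /=; by rewrite mscale1.
- by rewrite qnf_scale qnf_addl qnf_addr mscaleDr.
- by rewrite qnf_addl qnf_addr mscaleDl.
Defined.
End Quotient.

Section Restrict.
Variables (A B : nzRingType) (phi : {rmorphism A -> B}) (M : module B).

Definition restrict : module A.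
Proof.
refine (@Module A M mzero madd mopp (fun a x => mscale (phi a) x)
          _ _ _ _ _ _ _ _); intros.
- exact: maddA.
- exact: maddC.
- exact: madd0.
- exact: maddN.
- by rewrite mscaleA rmorphM.
- by rewrite rmorph1 mscale1.
- exact: mscaleDr.
- by rewrite rmorphD mscaleDl.
Defined.
End Restrict.

Definition ideal_gen (A : comNzRingType) (G : A -> Prop) : A -> Prop :=
  fun s => exists l : seq (A * A),
    (forall p, List.In p l -> G p.2) /\ s = \sum_(p <- l) p.1 * p.2.

Definition is_ideal (A : comNzRingType) (J : A -> Prop) : Prop :=
  [/\ J 0, (forall x y, J x -> J y -> J (x + y)) & (forall r x, J x -> J (r * x))].

Definition noetherian (A : comNzRingType) : Prop :=
  forall J : A -> Prop, is_ideal J ->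
    exists gens : seq A, forall x, J x <-> ideal_gen (fun y => List.In y gens) x.

Definition ideal_mul (A : comNzRingType) (J K : A -> Prop) : A -> Prop :=
  ideal_gen (fun s => exists a b, [/\ J a, K b & s = a * b]).

Fixpoint ideal_pow (A : comNzRingType) (J : A -> Prop) (n : nat) : A -> Prop :=
  match n with
  | 0 => fun _ => True
  | n.+1 => ideal_mul (ideal_pow J n) J
  end.

Definition ideal_vars (R : comNzRingType) (k : nat) : {mpoly R[k]} -> Prop :=
  ideal_gen (fun s => exists i : 'I_k, s = 'X_i).

Arguments ideal_vars : clear implicits.

Definition ideal_mod (A : comNzRingType) (J : A -> Prop) (M : module A) : M -> Prop :=
  fun x => exists l : seq (A * M),
    (forall p, List.In p l -> J p.1) /\
    x = msum [seq mscale p.1 p.2 | p <- l].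

Arguments ideal_mod {A} J M _.

Lemma msum_cat (A : nzRingType) (M : module A) (l1 l2 : seq M) :
  msum (l1 ++ l2) = madd (msum l1) (msum l2).
Proof.
elim: l1 => [|x l IH] /=; first by rewrite madd0.
by rewrite IH maddA.
Qed.

Lemma ideal_mod_sub (A : comNzRingType) (J : A -> Prop) (M : module A) :
  is_submodule (ideal_mod J M).
Proof.
split.
- by exists [::].
- move=> x y [l1 [h1 ->]] [l2 [h2 ->]]; exists (l1 ++ l2); split.
    by move=> p hp; case: (List.in_app_or _ _ _ hp) => [/h1|/h2].
  by rewrite map_cat msum_cat.
- move=> a x [l [h ->]]; exists [seq (p.1, mscale a p.2) | p <- l]; split.
    by move=> p hp; case: (proj1 (List.in_map_iff _ _ _) hp) => q [<- /h].
  elim: l {h} => [|p l IH] /=; first by rewrite -(mscale0 (mzero : M)) mscaleA mulr0.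
  by rewrite mscaleDr IH !mscaleA mulrC.
Qed.

Lemma ideal_mod_subR (R : comNzRingType) (k : nat) (J : {mpoly R[k]} -> Prop)
  (M : module {mpoly R[k]}) :
  @is_submodule R (restrict (mpolyC k (R := R)) M) (ideal_mod J M).
Proof.
case: (ideal_mod_sub J M) => h0 h1 h2; split => //.
move=> a x; exact: h2.
Qed.

Definition quotR (R : comNzRingType) (k : nat) (M : module {mpoly R[k]})
  (J : {mpoly R[k]} -> Prop) : module R :=
  quotient (ideal_mod_subR J M).

Local Open Scope ereal_scope.

Definition is_length_function (R : comNzRingType)
    (lam : module R -> \bar Rdefinitions.R) : Prop :=
  [/\ (forall M, 0 <= lam M),
      (forall M : module R, (forall x : M, x = mzero) -> lam M = 0),
      (forall M N : module R, isomorphic M N -> lam M = lam N),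
      (forall M1 M2 M3 : module R, short_exact M1 M2 M3 ->
          lam M2 = lam M1 + lam M3) &
      (forall N : module R,
          lam N = ereal_sup [set v | exists (P : N -> Prop) (HP : is_submodule P),
                              fg_module (submodule HP) /\ v = lam (submodule HP)])].

(* Main.v *)
(** Put N_n = I^n M / I^(n+1) M; then c_n is the sum of the lengths of
    N_0, ..., N_n, and it suffices that n |-> length N_n is eventually
    polynomial of degree < k (Hilbert-Serre).  All graded modules occurring in
    the proof are kept as pairs of sequences of R-submodules Q_n <= P_n of the
    single R-module M, standing for the graded module with pieces P_n / Q_n.
    Kernel and cokernel of multiplication by x_k on such a pair are again such
    pairs, on which x_k acts as zero, so the induction on k drops one variable;
    finite generation enters only as the ascending chain condition on graded
    submodules, which passes to them for free.  The chain condition for (N_n)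
    is Hilbert's basis theorem, proved by following the ascending submodules of
    leading coefficients with respect to the last variable. *)

Require Import Defs.
From HB Require Import structures.
From mathcomp Require Import all_boot all_order all_algebra.
From mathcomp Require Import mpoly.
From mathcomp Require Import boolp classical_sets constructive_ereal ereal Rstruct.
Import Order.TTheory GRing.Theory Num.Theory.
Local Open Scope ring_scope.

Set Implicit Arguments.
Unset Strict Implicit.
Unset Printing Implicit Defensive.

(** * Linear maps and quotient modules *)

Lemma mopp0 (A : nzRingType) (V : module A) : mopp mzero = mzero :> V.
Proof. by rewrite -[LHS](maddr0) maddN. Qed.

Section Linear.
Variables (A : nzRingType) (V W : module A) (f : V -> W).
Hypothesis linf : is_linear f.

Lemma lin0 : f mzero = mzero.
Proof. by rewrite -(mscale0 (mzero : V)) linf.2 mscale0. Qed.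

Lemma linD x y : f (madd x y) = madd (f x) (f y).
Proof. exact: linf.1. Qed.

Lemma linZ a x : f (mscale a x) = mscale a (f x).
Proof. exact: linf.2. Qed.

Lemma linN x : f (mopp x) = mopp (f x).
Proof. by rewrite -!mscaleN1 linZ. Qed.

Lemma lin_ker_inj : (forall x, f x = mzero -> x = mzero) -> injective f.
Proof.
move=> kf x y exy; apply: (@madd_cancel _ _ (mopp y)).
by rewrite maddN maddC; apply: kf; rewrite linD linN exy maddNr.
Qed.

End Linear.

Lemma lin_iter (A : nzRingType) (V : module A) (f : V -> V) m :
  is_linear f -> is_linear (iter m f).
Proof.
by move=> linf; elim: m => [|m IH]; split=> //= *;
  rewrite ?(linD IH) ?(linZ IH) ?(linD linf) ?(linZ linf).
Qed.

Section QuotientMap.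
Variables (A : nzRingType) (V : module A) (P : V -> Prop).
Hypothesis HP : is_submodule P.

Definition qproj (x : V) : quotient HP := qmk HP x.

Lemma qproj_linear : is_linear qproj.
Proof.
split=> [x y|a x]; apply: q_eq => /=.
  by rewrite qnf_addl // qnf_addr.
by rewrite qnf_scale.
Qed.

Lemma qproj_surj (u : quotient HP) : exists x, qproj x = u.
Proof. by case: u => x ex; exists x; apply: q_eq. Qed.

Lemma qproj_ker x : qproj x = mzero <-> P x.
Proof.
have [P0 PD _] := HP; split=> [/(congr1 (@proj1_sig _ _)) /= e|Px].
  have := PD _ _ (subP_opp HP (qnf_spec HP x)) (qnf_spec HP mzero).
  by rewrite e mopp0 maddr0 moppD moppK [madd (mopp _) x]maddC -maddA maddN maddr0.
by apply: q_eq => /=; apply: qnf_eq => //; rewrite mopp0 maddr0.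
Qed.

(** Elements of a quotient are canonical representatives, so evaluating [g] on them gives the lift.
    It is compatible with the projection because [qnf x] and [x] differ by an element of [P], which
    [g] kills. *)
Lemma quotient_lift (W : module A) (g : V -> W) : is_linear g ->
  (forall x, P x -> g x = mzero) ->
  exists h : quotient HP -> W, is_linear h /\ forall x, h (qproj x) = g x.
Proof.
move=> ling gP; pose h (u : quotient HP) := g (proj1_sig u).
have hE x : h (qproj x) = g x.
  have := gP _ (qnf_spec HP x); rewrite linD // linN // => e.
  by apply: (@madd_cancel _ _ (mopp (g x))); rewrite maddN maddC.
exists h; split=> //; split.
  move=> u v; have [x <-] := qproj_surj u; have [y <-] := qproj_surj v.
  by rewrite -(linD qproj_linear) !hE linD.
move=> a u; have [x <-] := qproj_surj u.
by rewrite -(linZ qproj_linear) !hE linZ.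
Qed.

Lemma quotient_iso (W : module A) (g : V -> W) : is_linear g ->
  (forall z, exists x, g x = z) -> (forall x, P x <-> g x = mzero) ->
  isomorphic (quotient HP) W.
Proof.
move=> ling surg kerg.
have [h [linh hE]] := quotient_lift ling (fun x => (kerg x).1).
exists h; split=> //.
have injh : injective h.
  apply: lin_ker_inj => // u; have [x <-] := qproj_surj u.
  by rewrite hE => /kerg/qproj_ker.
have surh z : exists u, h u = z.
  by have [x <-] := surg z; exists (qproj x).
exists (fun z => projT1 (cid (surh z))) => z; last exact: projT2 (cid (surh z)).
by apply: injh; exact: projT2 (cid (surh (h z))).
Qed.

End QuotientMap.

(** * The lattice of submodules *)

Record submod (A : nzRingType) (V : module A) := Submod {
  smem :> V -> Prop;
  smemP : is_submodule smem }.

Section Submod.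
Variables (A : nzRingType) (V : module A).
Implicit Types (P Q S : submod V) (x y : V).

Lemma sm0 P : P mzero.
Proof. by case: (smemP P). Qed.

Lemma smD P x y : P x -> P y -> P (madd x y).
Proof. by case: (smemP P) => _ h _; apply: h. Qed.

Lemma smZ P a x : P x -> P (mscale a x).
Proof. by case: (smemP P) => _ _ h; apply: h. Qed.

Lemma smN P x : P x -> P (mopp x).
Proof. exact: (subP_opp (smemP P)). Qed.

Lemma smDl P x y : P x -> P (madd x y) -> P y.
Proof. by move=> Px /(smD (smN Px)); rewrite maddA maddN madd0. Qed.

Lemma submod_ext P Q : (forall x, P x <-> Q x) -> P = Q.
Proof.
case: P Q => [P HP] [Q HQ] /= e.
have ePQ : P = Q by apply: funext => x; apply: propext.
by subst Q; congr Submod; apply: Prop_irrelevance.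
Qed.

Lemma top_sub : is_submodule (fun _ : V => True).
Proof. by []. Qed.
Definition smtop := Submod top_sub.

Lemma add_sub P Q :
  is_submodule (fun z => exists x y, [/\ P x, Q y & z = madd x y]).
Proof.
split.
- by exists mzero, mzero; rewrite madd0; split=> //; apply: sm0.
- move=> _ _ [x [y [Px Qy ->]]] [x' [y' [Px' Qy' ->]]].
  by exists (madd x x'), (madd y y'); split; [apply: smD|apply: smD|rewrite madd4].
- move=> a _ [x [y [Px Qy ->]]].
  by exists (mscale a x), (mscale a y); split; rewrite ?mscaleDr //; apply: smZ.
Qed.
Definition smadd P Q := Submod (add_sub P Q).

Lemma smaddl P Q x : P x -> smadd P Q x.
Proof. by move=> Px; exists x, mzero; rewrite maddr0; split=> //; apply: sm0. Qed.

Lemma smaddr P Q x : Q x -> smadd P Q x.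
Proof. by move=> Px; exists mzero, x; rewrite madd0; split=> //; apply: sm0. Qed.

Lemma smadd_le P Q S x : (forall y, P y -> S y) -> (forall y, Q y -> S y) ->
  smadd P Q x -> S x.
Proof. by move=> PS QS [y [z [/PS Sy /QS Sz ->]]]; apply: smD. Qed.

Lemma cap_sub P Q : is_submodule (fun x => P x /\ Q x).
Proof.
split; first by split; apply: sm0.
- by move=> x y [? ?] [? ?]; split; apply: smD.
- by move=> a x [? ?]; split; apply: smZ.
Qed.
Definition smcap P Q := Submod (cap_sub P Q).

Lemma pull_sub P Q :
  is_submodule (M := submodule (smemP P)) (fun u => Q (proj1_sig u)).
Proof.
by split=> [|x y Qx Qy|a x Qx] /=; [apply: sm0|apply: smD|apply: smZ].
Qed.

Section Image.
Variable f : V -> V.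
Hypothesis linf : is_linear f.

Lemma im_sub P : is_submodule (fun y => exists2 x, P x & y = f x).
Proof.
split; first by exists mzero; [apply: sm0|rewrite lin0].
- by move=> _ _ [x Px ->] [y Py ->]; exists (madd x y); rewrite ?linD //; apply: smD.
- by move=> a _ [x Px ->]; exists (mscale a x); rewrite ?linZ //; apply: smZ.
Qed.
Definition smim P := Submod (im_sub P).

Lemma mem_smim P x : P x -> smim P (f x).
Proof. by exists x. Qed.

Lemma preim_sub P : is_submodule (fun x => P (f x)).
Proof.
split; first by rewrite lin0 //; apply: sm0.
- by move=> x y Px Py; rewrite linD //; apply: smD.
- by move=> a x Px; rewrite linZ //; apply: smZ.
Qed.
Definition smpreim P := Submod (preim_sub P).

Lemma smpreimE P x : smpreim P x = P (f x).
Proof. by []. Qed.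

End Image.
End Submod.

Arguments smem : simpl never.

(** * Lengths of subquotients *)

Section Length.
Variables (R : comNzRingType) (V : module R).
Variable lam : module R -> \bar Rdefinitions.R.
Hypothesis lamP : is_length_function lam.
Implicit Types P Q S : submod V.
Local Open Scope ereal_scope.

(** As [pull_sub] cuts [Q] down to [P], this is the length of P/(P ∩ Q). *)
Definition qlen P Q := lam (quotient (pull_sub P Q)).

Lemma qlen_ge0 P Q : 0 <= qlen P Q.
Proof. by case: lamP => h _ _ _ _; apply: h. Qed.

Lemma qlen_eq0 P Q : (forall x, P x -> Q x) -> qlen P Q = 0.
Proof.
move=> PQ; case: lamP => _ h _ _ _; apply: h => u.
by have [x <-] := qproj_surj u; apply/qproj_ker/PQ/(proj2_sig x).
Qed.

(** Additivity of length on the exact sequence 0 -> S/Q -> P/Q -> P/S -> 0. *)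
Lemma qlen_add P Q S : (forall x, Q x -> S x) -> (forall x, S x -> P x) ->
  qlen P Q = qlen S Q + qlen P S.
Proof.
move=> QS SP; case: lamP => _ _ _ h _; apply: h.
pose i (u : submodule (smemP S)) : submodule (smemP P) :=
  exist _ (proj1_sig u) (SP _ (proj2_sig u)).
have lini : is_linear (fun u => qproj (pull_sub P Q) (i u)).
  have l := qproj_linear (pull_sub P Q).
  by split=> [x y|a x]; rewrite -(linD l, linZ l); congr qproj; apply: sub_eq.
have [f [linf fE]] := @quotient_lift _ _ _ (pull_sub S Q) _ _ lini
  (fun x Qx => (qproj_ker (pull_sub P Q) (i x)).2 Qx).
have [g [ling gE]] := @quotient_lift _ _ _ (pull_sub P Q) _ _
  (qproj_linear (pull_sub P S))
  (fun x Qx => (qproj_ker (pull_sub P S) x).2 (QS _ Qx)).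
exists f, g; split=> //.
- apply: lin_ker_inj => // u; have [x <-] := qproj_surj u.
  by rewrite fE => /qproj_ker Qx; apply/qproj_ker.
- by move=> z; have [x <-] := qproj_surj z; exists (qproj (pull_sub P Q) x).
move=> y; have [x <-] := qproj_surj y; rewrite gE; split.
  move=> [u]; have [s <-] := qproj_surj u; rewrite fE => e.
  by rewrite -gE -e gE; apply/qproj_ker => /=; exact: (proj2_sig s).
by move=> /qproj_ker Sx; exists (qproj (pull_sub S Q) (exist _ _ Sx));
  rewrite fE; congr qproj; apply: sub_eq.
Qed.

(** The map [f] induces an isomorphism from P/(P ∩ f^-1(Q)) onto (f(P) + Q)/Q. *)
Lemma qlen_im f (linf : is_linear f) P Q :
  qlen P (smpreim linf Q) = qlen (smadd (smim linf P) Q) Q.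
Proof.
case: lamP => _ _ h _ _; apply: h.
set T := smadd _ Q; have l := qproj_linear (pull_sub T Q).
pose i (u : submodule (smemP P)) : submodule (smemP T) :=
  exist _ (f (proj1_sig u)) (smaddl Q (mem_smim linf (proj2_sig u))).
apply: (@quotient_iso _ _ _ _ _ (fun u => qproj (pull_sub T Q) (i u))).
- by split=> [x y|a x]; rewrite -(linD l, linZ l); congr qproj; apply: sub_eq;
    rewrite /= ?linD ?linZ.
- move=> z; have [[y Ty] <-] := qproj_surj z.
  have [_ [q [[p Pp ->] Qq ey]]] := Ty.
  pose b : submodule (smemP T) := exist _ q (smaddr (smim linf P) Qq).
  exists (exist _ p Pp); set a := i _.
  have -> : exist _ y Ty = madd a b :> submodule (smemP T) by apply: sub_eq.
  by rewrite (linD l) ((qproj_ker (pull_sub T Q) b).2 Qq) maddr0.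
by move=> x; rewrite qproj_ker.
Qed.

Lemma lam_quotient (Q : submod V) :
  lam (quotient (smemP Q)) = qlen (smtop V) Q.
Proof.
case: lamP => _ _ h _ _; apply/esym/h.
apply: (@quotient_iso _ _ _ _ _ (fun u : submodule (smemP (smtop V)) =>
    qproj (smemP Q) (proj1_sig u))).
- by have l := qproj_linear (smemP Q); split=> *; rewrite -(linD l, linZ l).
- move=> z; have [x <-] := qproj_surj z.
  by exists (exist _ x I).
by move=> x; rewrite qproj_ker.
Qed.

End Length.

(** * Chain conditions over a Noetherian ring *)

Definition acc_between (A : nzRingType) (V : module A) (P Q : submod V) : Prop :=
  forall F : nat -> submod V,
    (forall j x, Q x -> F j x) -> (forall j x, F j x -> F j.+1 x) ->
    (forall j x, F j x -> P x) ->
    exists J, forall j x, (J <= j)%N -> F j x -> F J x.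

Lemma chain_mono (A : nzRingType) (V : module A) (F : nat -> submod V) i j x :
  (forall j x, F j x -> F j.+1 x) -> (i <= j)%N -> F i x -> F j x.
Proof.
move=> Fmono /subnK <- Fx; elim: (j - i)%N => //= n IH.
exact: Fmono.
Qed.

Section Noetherian.
Variables (R : comNzRingType).
Hypothesis noethR : noetherian R.

(** The union of the chain is an ideal, and its finitely many generators all occur at a common
    stage. *)
Lemma ideal_acc (J : nat -> R -> Prop) : (forall j, is_ideal (J j)) ->
  (forall j a, J j a -> J j.+1 a) ->
  exists N, forall j a, (N <= j)%N -> J j a -> J N a.
Proof.
move=> idJ Jmono.
have mono i j a : (i <= j)%N -> J i a -> J j a.
  by move=> /subnK <- Ja; elim: (j - i)%N => //= n; apply: Jmono.
have idU : is_ideal (fun a => exists j, J j a).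
  split; first by exists 0%N; case: (idJ 0%N).
    move=> x y [i Jx] [j Jy]; exists (maxn i j); case: (idJ (maxn i j)) => _ JD _.
    by apply: JD; [apply: mono Jx; apply: leq_maxl|apply: mono Jy; apply: leq_maxr].
  by move=> r x [j Jx]; exists j; case: (idJ j) => _ _; apply.
have [gens genP] := noethR idU.
have genJ y : List.In y gens -> exists j, J j y.
  move=> gy; apply/genP; exists [:: (1, y)]; split; last by rewrite big_seq1 mul1r.
  by move=> p [<-|].
have [N JN] : exists N, forall y, List.In y gens -> J N y.
  elim: gens genJ {genP} => [|g gs IH] hg; first by exists 0%N.
  have [|N JN] := IH; first by move=> y hy; apply: hg; right.
  have [|i Ji] := hg g; first by left.
  exists (maxn i N) => y [<-|/JN]; last by apply: mono; apply: leq_maxr.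
  by apply: mono Ji; apply: leq_maxl.
exists N => j a _ Ja.
have /genP [l [lg ->]] : exists j, J j a by exists j.
case: (idJ N) => J0 JD JM.
elim: l lg => [|p l IH] lg; first by rewrite big_nil.
rewrite big_cons; apply: JD; last by apply: IH => q ql; apply: lg; right.
by apply/JM/JN/lg; left.
Qed.

Variable V : module R.
Implicit Types (P Q : submod V).

Lemma line_sub (g : V) : is_submodule (fun x => exists a, x = mscale a g).
Proof.
split; first by exists 0; rewrite mscale0.
- by move=> _ _ [a ->] [b ->]; exists (a + b); rewrite mscaleDl.
- by move=> c _ [a ->]; exists (c * a); rewrite mscaleA.
Qed.
Definition line g := Submod (line_sub g).

Fixpoint spanadd (gs : seq V) (Q : submod V) : submod V :=
  if gs is g :: gs' then smadd (line g) (spanadd gs' Q) else Q.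

Lemma spanadd_sub gs Q x : Q x -> spanadd gs Q x.
Proof. by move=> Qx; elim: gs => //= g gs; apply: smaddr. Qed.

Lemma mem_spanadd gs Q g : List.In g gs -> spanadd gs Q g.
Proof.
elim: gs => //= h gs IH [->|/IH]; last exact: smaddr.
by apply: smaddl; exists 1; rewrite mscale1.
Qed.

(** Induction on the generators. With T spanned over Q by the generators after g, a chain F_j is
    controlled by the submodules F_j ∩ T and by the ideals of those a with a g in F_j + T; both
    stabilise. *)
Lemma spanadd_acc gs Q : acc_between (spanadd gs Q) Q.
Proof.
elim: gs => [|g gs IH] F QF Fmono FP; first by exists 0%N => j x _ /FP; apply: QF.
pose T := spanadd gs Q.
have [] := IH (fun j => smcap (F j) T).
- by move=> j x Qx; split; [apply: QF|apply: spanadd_sub].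
- by move=> j x [/Fmono].
- by move=> j x [].
move=> J1 HJ1.
have [] := @ideal_acc (fun j a => smadd (F j) T (mscale a g)).
- move=> j; split; first by rewrite mscale0; apply: sm0.
    by move=> a b Fa Fb; rewrite mscaleDl; apply: smD.
  by move=> r a Fa; rewrite -mscaleA; apply: smZ.
- move=> j a; apply: smadd_le => y; last exact: smaddr.
  by move=> /Fmono; apply: smaddl.
move=> J2 HJ2; pose J := maxn J1 J2; exists J => j x leJj Fx.
have [_ [t [[a ->] Tt ex]]] := FP _ _ Fx.
have : smadd (F j) T (mscale a g).
  by exists x, (mopp t); split=> //; [apply: smN|rewrite ex -maddA maddNr maddr0].
move=> /(HJ2 _ _ (leq_trans (leq_maxr _ _) leJj)) [f [u [Ff Tu eag]]].
have FJf : F J f by apply: chain_mono Ff; rewrite // leq_maxr.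
rewrite ex eag -maddA; apply: smD => //.
(* Here a g = f + u with f in F_J, so u + t = x - f lies both in T and in F_j. *)
have [] : smcap (F J1) T (madd u t); last first.
  by move=> /(chain_mono Fmono) FJ _; apply: FJ; apply: leq_maxl.
apply: (HJ1 j); first by apply: leq_trans leJj; apply: leq_maxl.
split; last exact: smD.
apply: (@smDl _ _ _ f); first by apply: chain_mono FJf.
by rewrite maddA -eag -ex.
Qed.

End Noetherian.

(** * Graded submodules and their chain condition *)

Section Graded.
Variables (R : nzRingType) (V : module R) (X : nat -> V -> V).
Hypothesis linX : forall i, is_linear (X i).
Hypothesis comX : forall i j x, X i (X j x) = X j (X i x).
Implicit Types (P Q F G : nat -> submod V).

(** The operators are indexed by all natural numbers and only those below [k] act, so the number of
    variables can drop without a change of types. *)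
Definition gstable k F : Prop :=
  forall i n x, (i < k)%N -> F n x -> F n.+1 (X i x).

(** The graded module with pieces P_n/Q_n is Noetherian over the polynomials in the first [k]
    operators. One index [J] serves all degrees at once. *)
Definition gacc k P Q : Prop :=
  forall F : nat -> nat -> submod V,
    (forall j, gstable k (F j)) ->
    (forall j n x, Q n x -> F j n x) -> (forall j n x, F j n x -> F j.+1 n x) ->
    (forall j n x, F j n x -> P n x) ->
    exists J, forall j n x, (J <= j)%N -> F j n x -> F J n x.

Lemma gacc_sub k P Q P' Q' : (forall n x, P' n x -> P n x) ->
  (forall n x, Q n x -> Q' n x) -> gacc k P Q -> gacc k P' Q'.
Proof.
move=> P'P QQ' acc F Fst Q'F Fmono FP'; apply: acc => // j n x.
  by move=> /QQ'; apply: Q'F.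
by move=> /FP'/P'P.
Qed.

(** A family between [Q] and [P] is automatically stable under [X k], because [X k] sends all of [P]
    into [Q]. *)
Lemma gacc_drop k P Q : (forall n x, P n x -> Q n.+1 (X k x)) ->
  gacc k.+1 P Q -> gacc k P Q.
Proof.
move=> XPQ acc F Fst QF Fmono FP; apply: acc => // j i n x.
rewrite ltnS leq_eqVlt => /orP[/eqP -> /FP/XPQ|]; [exact: QF|exact: Fst].
Qed.

Lemma gacc0_eventually P Q : (forall n x, Q n x -> P n x) -> gacc 0 P Q ->
  exists N, forall n x, (N <= n)%N -> P n x -> Q n x.
Proof.
move=> QP acc.
(* Without operators every family is stable. The test chain equals [P] in degrees below [j] and [Q]
   from there on; its stabilisation at [J] forces P_n into Q_n for n >= J. *)
have [||||J HJ] := acc (fun j n => if (n < j)%N then P n else Q n) => //.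
- by move=> j n x Qx; case: ifP => // _; apply: QP.
- move=> j n x; case: ifP => [lnj Px|_ Qx]; first by rewrite ltnW.
  by case: ifP => // _; apply: QP.
- by move=> j n x; case: ifP => // _; apply: QP.
exists J => n x leJn Px.
by have := HJ n.+1 n x; rewrite ltnS leqnn ltnNge leJn leqW //=; apply.
Qed.

Fixpoint sumim k (P Q : submod V) : submod V :=
  if k is k'.+1 then smadd (smim (linX k') P) (sumim k' P Q) else Q.

Lemma sumim_sub k (P Q : submod V) x : Q x -> sumim k P Q x.
Proof. by move=> Qx; elim: k => //= k; apply: smaddr. Qed.

Lemma mem_sumim k i (P Q : submod V) x :
  (i < k)%N -> P x -> sumim k P Q (X i x).
Proof.
move=> ik Px; elim: k ik => //= k IH; rewrite ltnS leq_eqVlt => /orP[/eqP ->|/IH].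
  by apply: smaddl; apply: mem_smim.
exact: smaddr.
Qed.

Lemma sumim_le k (P Q S : submod V) x :
  (forall i y, (i < k)%N -> P y -> S (X i y)) -> (forall y, Q y -> S y) ->
  sumim k P Q x -> S x.
Proof.
move=> PS QS; elim: k x PS => [|k IH] x PS /=; first exact: QS.
apply: smadd_le => y; first by move=> [z Pz ->]; apply: PS.
by apply: IH => i z ik; apply: PS; rewrite ltnW.
Qed.

(** * Hilbert's basis theorem for graded modules generated in degree zero *)

Section Generated.
Variables (P0 : submod V) (Q : nat -> submod V).
Hypothesis QP0 : forall x, Q 0%N x -> P0 x.
Hypothesis accP0 : acc_between P0 (Q 0%N).

(** Numerators of the graded module generated over [Q] by [P0] in degree 0. *)
Fixpoint gen k n : submod V :=
  if n is n'.+1 then sumim k (gen k n') (Q n) else P0.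

Lemma gen_sub k n x : Q n x -> gen k n x.
Proof. by case: n => [|n]; [apply: QP0|apply: sumim_sub]. Qed.

Lemma gen_stable k : gstable k (gen k).
Proof. by move=> i n x; apply: mem_sumim. Qed.

Section Step.
Variable k : nat.
Hypothesis Qst : gstable k.+1 Q.

(* Elements of degree n that are polynomials in X k of degree < m with
   coefficients in gen k. *)
Fixpoint low m n : submod V :=
  if m is m'.+1 then
    if (m' <= n)%N then
      smadd (smim (lin_iter m' (linX k)) (gen k (n - m'))) (low m' n)
    else low m' n
  else Q n.

Lemma iter_com m i x : iter m (X k) (X i x) = X i (iter m (X k) x).
Proof. by elim: m => //= m ->; rewrite comX. Qed.

Lemma low_sub m n x : Q n x -> low m n x.
Proof.
by move=> Qx; elim: m => //= m IH; case: ifP => // _; apply: smaddr.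
Qed.

Lemma lowS m n x : low m n x -> low m.+1 n x.
Proof. by move=> lx /=; case: ifP => // _; apply: smaddr. Qed.

Lemma low_stable m : gstable k (low m).
Proof.
elim: m => [|m IH] i n x ik /=; first by apply: Qst; rewrite ltnW.
case: (leqP m n) => [lmn|lnm] lx; last by have := IH _ _ _ ik lx;
  case: ifP => // _; apply: smaddr.
rewrite leqW //; move: lx => [_ [r [[a ga ->] lr ->]]].
rewrite linD //; apply: smD; last by apply/smaddr/IH.
apply: smaddl; rewrite -iter_com; apply: mem_smim.
by rewrite subSn //; apply: gen_stable.
Qed.

Lemma low_X m n x : low m n x -> low m.+1 n.+1 (X k x).
Proof.
elim: m x => [|m IH] x.
  by move=> Qx; apply: low_sub; apply: Qst.
rewrite [low m.+1 n]/=; case: (leqP m n) => [lmn|lnm] lx; last by apply/lowS/IH.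
move: lx => [_ [r [[a ga ->] lr ->]]].
rewrite linD //; apply: smD; last by apply/lowS/IH.
rewrite [low _.+2 _]/= ltnS lmn; apply: smaddl.
by apply: (@mem_smim _ _ _ (lin_iter m.+1 (linX k))); rewrite subSS.
Qed.

(** An element of degree n has degree at most n in [X k], hence the strict bound n + 1. *)
Lemma gen_low n x : gen k.+1 n x -> low n.+1 n x.
Proof.
elim: n x => [|n IH] x; first by move=> Px;
  apply: smaddl; apply: (@mem_smim _ _ _ (lin_iter 0 (linX k)) P0).
apply: sumim_le => [i y|y Qy]; last exact: low_sub.
rewrite ltnS leq_eqVlt => /orP[/eqP ->|ik] /IH; first exact: low_X.
by move=> ly; apply: lowS; apply: low_stable.
Qed.

(* Leading coefficients of the elements of F of degree m in X k. *)
Definition lead (F : nat -> submod V) m n : submod V :=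
  smcap (gen k n)
    (smpreim (lin_iter m (linX k)) (smadd (F (m + n)%N) (low m (m + n)))).

Lemma lead_stable F m : gstable k.+1 F -> gstable k (lead F m).
Proof.
move=> Fst i n x ik [gx hx]; split; first exact: gen_stable.
move: hx => [f [r [Ff lr e]]]; rewrite smpreimE iter_com e linD // addnS.
exists (X i f), (X i r); split=> //; first by apply: Fst => //; rewrite ltnW.
exact: low_stable.
Qed.

Lemma sub_lead F m n x : Q n x -> lead F m n x.
Proof.
move=> Qx; split; first exact: gen_sub.
apply: smaddr; apply: low_sub.
by elim: m => //= m IH; rewrite addSn; apply: Qst.
Qed.

Lemma lead_mono F G m n x : (forall n x, F n x -> G n x) ->
  lead F m n x -> lead G m n x.
Proof.
move=> FG [gx [f [r [/FG Gf lr e]]]]; split=> //.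
by exists f, r.
Qed.

(** Multiplying by [X k] raises the degree in [X k] by one and keeps the leading coefficient. *)
Lemma leadS F m n x : gstable k.+1 F -> lead F m n x -> lead F m.+1 n x.
Proof.
move=> Fst [gx [f [r [Ff lr e]]]]; split=> //.
exists (X k f), (X k r); rewrite addSn; split; first exact: Fst.
  exact: low_X.
by rewrite /= e linD.
Qed.

(** Descent on the degree in [X k]: the leading coefficient of an element of [G] is also that of an
    element of [F], and subtracting the latter leaves an element of [G] of lower degree. *)
Lemma lead_le F G : (forall n x, Q n x -> F n x) ->
  (forall n x, F n x -> G n x) -> (forall m n x, lead G m n x -> lead F m n x) ->
  forall n x, gen k.+1 n x -> G n x -> F n x.
Proof.
move=> QF FG GF n x /gen_low; move: n.+1 => m.
elim: m x => [|m IH] x; first by move=> /QF.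
rewrite /=; case: leqP => [lmn|_]; last exact: IH.
move=> [_ [r [[a ga ->] lr ->]]] Gx.
have [] : lead F m (n - m) a.
  apply: GF; split=> //; rewrite smpreimE subnKC //.
  exists (madd (iter m (X k) a) r), (mopp r); split=> //; first exact: smN.
  by rewrite -maddA maddNr maddr0.
rewrite /= subnKC // => _ [f [r' [Ff lr' e]]].
(* Now x = f + (r' + r): the remainder is in [low m], and in [G] because x and f are. *)
move: Gx; rewrite e -maddA => Gx; apply: smD => //.
by apply: IH; [apply: smD|apply: smDl Gx; apply: FG].
Qed.

(** The submodules [lead (F j) m] ascend in both j and m. The diagonal chain settles at some J,
    which takes care of all m >= J; the finitely many m < J are settled one at a time, and N bounds
    all these stages. *)
Lemma gacc_step : gacc k (gen k) Q -> gacc k.+1 (gen k.+1) Q.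
Proof.
move=> acc F Fst QF Fmono FP.
have Fm i j n x : (i <= j)%N -> F i n x -> F j n x.
  by apply: (@chain_mono _ _ (fun j => F j n)) => j' y; apply: Fmono.
have leadm i j m m' n x : (i <= j)%N -> (m <= m')%N ->
    lead (F i) m n x -> lead (F j) m' n x.
  move=> lij lmm lx.
  have {}lx : lead (F j) m n x by apply: lead_mono lx => n' y; apply: Fm.
  apply: (@chain_mono _ _ (fun m => lead (F j) m n) m m' x _ lmm lx) => m1 y.
  exact: leadS.
have [||||J HJ] := acc (fun j => lead (F j) j).
- by move=> j; apply: lead_stable.
- by move=> j n x; apply: sub_lead.
- by move=> j n x; apply: leadm.
- by move=> j n x [].
have [N [leJN HN]] : exists N, (J <= N)%N /\ forall m j n x, (m < J)%N ->
    (N <= j)%N -> lead (F j) m n x -> lead (F N) m n x.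
  suff [N HN] : exists N, forall m j n x, (m < J)%N ->
      (N <= j)%N -> lead (F j) m n x -> lead (F N) m n x.
    exists (maxn J N); split; first exact: leq_maxl.
    move=> m j n x mJ; rewrite geq_max => /andP[_ lNj] /(HN _ _ _ _ mJ lNj).
    by apply: leadm => //; apply: leq_maxr.
  elim: J {HJ} => [|J [N HN]]; first by exists 0%N.
  have [||||N' HN'] := acc (fun j => lead (F j) J).
  - by move=> j; apply: lead_stable.
  - by move=> j n x; apply: sub_lead.
  - by move=> j n x; apply: leadm.
  - by move=> j n x [].
  exists (maxn N N') => m j n x; rewrite ltnS leq_eqVlt geq_max => mJ /andP[l1 l2].
  move: mJ => /orP[/eqP ->|mJ].
    by move=> /(HN' _ _ _ l2); apply: leadm => //; apply: leq_maxr.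
  by move=> /(HN _ _ _ _ mJ l1); apply: leadm => //; apply: leq_maxl.
exists N => j n x lNj Fx.
apply: (@lead_le (F N) (F j)) (FP _ _ _ Fx) Fx => [n' y|n' y|m n' y].
- exact: QF.
- exact: Fm.
case: (ltnP m J) => [mJ|Jm]; first exact: HN.
(* For m >= J, ascend to the diagonal at max(j, m), fall back to stage J by stabilisation, and
   ascend again to stage N and degree m. *)
move=> lx; have {lx} : lead (F (maxn j m)) (maxn j m) n' y.
  by apply: leadm lx; [apply: leq_maxl|apply: leq_maxr].
move=> /HJ lx; apply: leadm (lx _) => //.
by rewrite leq_max Jm orbT.
Qed.

End Step.

Lemma gacc_gen k : gstable k Q -> gacc k (gen k) Q.
Proof.
elim: k => [|k IH] Qst; last first.
  by apply: gacc_step => //; apply: IH => i n x ik; apply: Qst; rewrite ltnW.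
(* With no variables, [gen] is [P0] in degree 0 and [Q] in positive degrees, so only degree 0
   matters. *)
move=> F _ QF Fmono FP.
have [J HJ] := accP0 (fun j => QF j 0%N) (fun j => Fmono j 0%N) (fun j => FP j 0%N).
by exists J => j [|n] x; [apply: HJ|move=> _ /FP; apply: QF].
Qed.

End Generated.
End Graded.

(** * Eventually polynomial sequences and finite differences *)

Section EventuallyPolynomial.
Variable K : numFieldType.
Implicit Types (p q : {poly K}) (h d : nat -> K).

Lemma coef_1DX_exp n j : ((1 + 'X) ^+ n : {poly K})`_j = 'C(n, j)%:R.
Proof.
elim: n j => [|n IH] j; first by rewrite expr0 coef1 bin0n.
rewrite exprS mulrDl mul1r coefD coefXM IH.
by case: j => [|j]; rewrite ?bin0 ?addr0 //= IH binS natrD.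
Qed.

(** Induction on a size bound: c X^(m+1)/(m+1) has a difference with leading term c X^m, so
    subtracting that difference removes the top coefficient. Division by m + 1 is possible in
    characteristic zero. *)
Lemma antidifference p :
  exists2 q : {poly K}, (size q <= (size p).+1)%N & q \Po (1 + 'X) - q = p.
Proof.
suff H m (r : {poly K}) : (size r <= m)%N ->
    exists2 q : {poly K}, (size q <= m.+1)%N & q \Po (1 + 'X) - q = r by exact: H.
elim: m r => [|m IH] {}p.
  rewrite leqn0 size_poly_eq0 => /eqP ->; exists 0; first by rewrite size_poly0.
  by rewrite comp_poly0 subrr.
move=> szp; pose q0 : {poly K} := (p`_m / m.+1%:R) *: 'X^(m.+1).
have szq0 : (size q0 <= m.+2)%N.
  by rewrite (leq_trans (size_scale_leq _ _)) // size_polyXn.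
have [|q1 szq1 eq1] := IH (p - (q0 \Po (1 + 'X) - q0)).
  apply/leq_sizeP => j lemj; rewrite !coefB comp_polyZ comp_Xn_poly !coefZ.
  rewrite coef_1DX_exp coefXn; move: lemj; rewrite leq_eqVlt => /orP[/eqP <-|].
    by rewrite ltn_eqF // mulr0 subr0 binSn mulfVK ?subrr.
  rewrite leq_eqVlt => /orP[/eqP <-|ltj].
    by rewrite eqxx binn subrr subr0 nth_default.
  rewrite bin_small // gtn_eqF // !mulr0 !subr0 nth_default //.
  exact: leq_trans szp (ltnW ltj).
exists (q0 + q1).
  by rewrite (leq_trans (size_polyD _ _)) // geq_max szq0 ltnW.
by rewrite comp_polyD opprD addrACA eq1 addrC subrK.
Qed.

(** Since [size] is one more than the degree, [s] is a strict degree bound, and s = 0 means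
    eventually zero. *)
Definition evpoly s h := exists2 q : {poly K}, (size q <= s)%N &
  exists N, forall n, (N <= n)%N -> h n = q.[n%:R].

Lemma evpolyB s h d : evpoly s h -> evpoly s d -> evpoly s (fun n => h n - d n).
Proof.
move=> [p szp [N hp]] [q szq [N' hq]]; exists (p - q).
  by rewrite (leq_trans (size_polyD _ _)) // size_polyN geq_max szp.
exists (maxn N N') => n; rewrite geq_max => /andP[/hp -> /hq ->].
by rewrite hornerD hornerN.
Qed.

Lemma evpoly_shift s h : evpoly s h -> evpoly s (fun n => h n.+1).
Proof.
move=> [p szp [N hp]]; exists (p \Po (1 + 'X)).
  by rewrite size_comp_poly2 // addrC size_XaddC.
exists N => n leNn; rewrite hp ?leqW // horner_comp hornerD hornerX hornerC.
by rewrite -natr1 addrC.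
Qed.

Lemma evpoly_sum s h d : (forall n, h n.+1 = h n + d n) -> evpoly s d ->
  evpoly s.+1 h.
Proof.
move=> hS [p szp [N hp]]; have [q szq eq] := antidifference p.
(* The constant makes the antidifference agree with [h] at N; equal differences do the rest. *)
exists (q + (h N - q.[N%:R])%:P).
  rewrite (leq_trans (size_polyD _ _)) // geq_max (leq_trans szq) //=.
  by rewrite (leq_trans (size_polyC_leq1 _)).
exists N => n /subnK <-; elim: (n - N)%N => [|m IH].
  by rewrite add0n hornerD hornerC addrC subrK.
rewrite addSn hS IH hp ?leq_addl // -eq !hornerD hornerN !hornerC horner_comp.
rewrite hornerD hornerX hornerC nat1r.
by rewrite addrAC [q.[_] + _ in LHS]addrC subrK.
Qed.

End EventuallyPolynomial.

(** * The Hilbert-Serre induction on the number of variables *)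

Section HilbertSerre.
Variables (R : comNzRingType) (V : module R) (X : nat -> V -> V).
Hypothesis linX : forall i, is_linear (X i).
Hypothesis comX : forall i j x, X i (X j x) = X j (X i x).
Variable lam : module R -> \bar Rdefinitions.R.
Hypothesis lamP : is_length_function lam.
Local Notation len := (qlen lam).
Local Open Scope ereal_scope.

Lemma qlen_cap (P Q : submod V) : len P (smcap P Q) = len P Q.
Proof.
case: lamP => _ _ h _ _; apply: h.
apply: (@quotient_iso _ _ _ _ _ (qproj (pull_sub P Q))).
- exact: qproj_linear.
- exact: qproj_surj.
- by move=> x; rewrite qproj_ker; split=> [[]|Qx] //; split=> //; apply: (proj2_sig x).
Qed.

Lemma qlen_le (P Q S : submod V) : (forall x, Q x -> S x) ->
  (forall x, S x -> P x) -> len S Q <= len P Q /\ len P S <= len P Q.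
Proof.
move=> QS SP; rewrite (qlen_add lamP QS SP).
by split; [rewrite leeDl|rewrite leeDr] => //; apply: qlen_ge0.
Qed.

Lemma qlen_fineK (P Q : submod V) : len P Q < +oo ->
  (fine (len P Q))%:E = len P Q.
Proof. by move=> fin; rewrite fineK // ge0_fin_numE // qlen_ge0. Qed.

(** Adding the images of the X_i one at a time, each new layer is a quotient of P/Q through X_i, so
    its length is finite. *)
Lemma qlen_sumim k (P Q Q' : submod V) : (forall x, Q x -> P x) ->
  (forall i x, (i < k)%N -> Q x -> Q' (X i x)) -> len P Q < +oo ->
  len (sumim linX k P Q') Q' < +oo.
Proof.
move=> QP; elim: k => [|k IH] XQ fin; first by rewrite (qlen_eq0 lamP) ?ltry.
rewrite (@qlen_add _ _ _ lamP _ _ (sumim linX k P Q')).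
- apply: lte_add_pinfty; first by apply: IH => // i x ik; apply: XQ; rewrite ltnW.
  rewrite -(qlen_im lamP) -qlen_cap; apply: le_lt_trans fin.
  have [] // := @qlen_le P Q (smcap P (smpreim (linX k) (sumim linX k P Q'))).
    move=> x Qx; split; first exact: QP.
    by apply: sumim_sub; apply: XQ.
  by move=> x [].
- by move=> x; apply: sumim_sub.
- by move=> x; apply: smaddr.
Qed.

Theorem hilbert_serre k (P Q : nat -> submod V) :
  (forall n x, Q n x -> P n x) -> gstable X k P -> gstable X k Q ->
  gacc X k P Q -> (forall n, len (P n) (Q n) < +oo) ->
  evpoly k (fun n => fine (len (P n) (Q n))).
Proof.
elim: k P Q => [|k IH] P Q QP Pst Qst acc fin.
  have [N PQ] := gacc0_eventually QP acc.
  exists 0%R; first by rewrite size_poly0.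
  by exists N => n leNn; rewrite horner0 (qlen_eq0 lamP) // => x; apply: PQ.
pose ker n := smcap (P n) (smpreim (linX k) (Q n.+1)).
pose im n := smadd (smim (linX k) (P n)) (Q n.+1).
(* Nothing maps into degree 0, so the cokernel there is all of P_0/Q_0. *)
pose cok n := if n is n'.+1 then im n' else Q 0%N.
have Qker n x : Q n x -> ker n x by move=> Qx; split; [apply: QP|apply: Qst].
have kerP n x : ker n x -> P n x by case.
have Qcok n x : Q n x -> cok n x by case: n => // n; apply: smaddr.
have cokP n x : cok n x -> P n x.
  case: n => [|n]; first exact: QP.
  by apply: smadd_le => [_ [y Py ->]|]; [apply: Pst|apply: QP].
have fink n : len (ker n) (Q n) < +oo.
  by apply: le_lt_trans (fin n); have [] := qlen_le (@Qker n) (@kerP n).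
have finc n : len (P n) (cok n) < +oo.
  by apply: le_lt_trans (fin n); have [] := qlen_le (@Qcok n) (@cokP n).
have evk : evpoly k (fun n => fine (len (ker n) (Q n))).
  apply: IH => //.
  - move=> i n x ik [Px Qx]; split; first by apply: Pst => //; apply: ltnW.
    by rewrite smpreimE comX; apply: Qst => //; apply: ltnW.
  - by move=> i n x ik; apply: Qst; apply: ltnW.
  - by apply: gacc_drop; [move=> n x []|apply: gacc_sub acc].
have evc : evpoly k (fun n => fine (len (P n) (cok n))).
  apply: IH => //.
  - by move=> i n x ik; apply: Pst; apply: ltnW.
  - move=> i [|n] x ik; first by move=> Qx; apply: Qcok; apply: Qst => //; apply: ltnW.
    move=> [_ [q [[p Pp ->] Qq ->]]]; rewrite linD // comX.
    apply: smD; last by apply: Qcok; apply: Qst => //; apply: ltnW.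
    by apply: smaddl; apply: mem_smim; apply: Pst => //; apply: ltnW.
  - apply: gacc_drop; last by apply: gacc_sub acc.
    by move=> n x Px; apply: smaddl; apply: mem_smim.
(* The sequence 0 -> ker_n/Q_n -> P_n/Q_n -> P_(n+1)/Q_(n+1) -> P_(n+1)/cok_(n+1) -> 0 is exact, so
   the difference of the Hilbert function is the cokernel length in degree n + 1 minus the kernel
   length in degree n. *)
apply: evpoly_sum (evpolyB (evpoly_shift evc) evk) => n /=.
have e1 := qlen_add lamP (@Qker n) (@kerP n).
have e2 := qlen_add lamP (@Qcok n.+1) (@cokP n.+1).
move: e1 e2; rewrite qlen_cap (qlen_im lamP) -/(im n).
have fini : len (im n) (Q n.+1) < +oo.
  by apply: le_lt_trans (fin n.+1); have [] := qlen_le (@Qcok n.+1) (@cokP n.+1).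
(* All five lengths are finite, so both equations pass to the reals, where they can be
   subtracted. *)
rewrite -[len (P n) _]qlen_fineK // -[len (P n.+1) (Q _)]qlen_fineK //.
rewrite -[len (im n) _]qlen_fineK // -[len (ker n) _]qlen_fineK //.
rewrite -[len (P n.+1) (im n)]qlen_fineK; last exact: (finc n.+1).
move=> [->] [->] /=.
rewrite [(_ + fine (len (im n) _))%R]addrC -addrA; congr (_ + _)%R.
by rewrite addrC subrK.
Qed.

End HilbertSerre.

(** * The filtration of M by powers of the ideal of variables *)

Lemma ideal_gen_ind (A : comNzRingType) (G T : A -> Prop) : T 0 ->
  (forall x y, T x -> T y -> T (x + y)) -> (forall r g, G g -> T (r * g)) ->
  forall s, ideal_gen G s -> T s.
Proof.
move=> T0 TD TG _ [l [lG ->]]; elim: l lG => [|p l IH] lG; first by rewrite big_nil.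
rewrite big_cons; apply: TD; first by apply/TG/lG; left.
by apply: IH => q ql; apply: lG; right.
Qed.

Lemma mem_ideal_gen (A : comNzRingType) (G : A -> Prop) r g :
  G g -> ideal_gen G (r * g).
Proof.
by move=> Gg; exists [:: (r, g)]; split=> [p [<-|]|] //; rewrite big_seq1.
Qed.

Lemma ideal_genD (A : comNzRingType) (G : A -> Prop) s t :
  ideal_gen G s -> ideal_gen G t -> ideal_gen G (s + t).
Proof.
move=> [l [lG ->]] [l' [lG' ->]]; exists (l ++ l'); split; last by rewrite big_cat.
by move=> p /(@List.in_app_or _ _ _ _) [/lG|/lG'].
Qed.

(** A monomial other than 1 is divisible by some variable. *)
Lemma mpoly_const_add_vars (R : comNzRingType) k (p : {mpoly R[k]}) :
  exists c t, ideal_vars R k t /\ p = c%:MP + t.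
Proof.
elim/mpolyind: p => [|c m p _ _ [c' [t [It ->]]]].
  exists 0, 0; rewrite mpolyC0 addr0; split=> //.
  by exists [::]; rewrite big_nil.
have [/existsP[i mi]|/existsPn m0] := boolP [exists i, m i != 0%N].
  exists c', (c *: 'X_[m] + t); split; last by rewrite addrCA.
  apply: ideal_genD => //.
  have /submK <- : (U_(i) <= m)%MM.
    apply/mnm_lepP => j; rewrite mnm1E; case: eqP => // <-.
    by rewrite lt0n.
  by rewrite mpolyXD scalerAl; apply: mem_ideal_gen; exists i.
have -> : m = 0%MM by apply/mnmP => i; rewrite mnm0E; apply/eqP/negbNE/m0.
by exists (c + c'), t; rewrite mpolyX0 alg_mpolyC mpolyCD addrA.
Qed.

Section PolynomialModule.
Variables (R : comNzRingType) (k : nat) (M : module {mpoly R[k]}).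
Local Notation I := (ideal_vars R k).
Local Notation V := (restrict (mpolyC k (R := R)) M).

Definition idmod J : submod V := Submod (ideal_mod_subR J M).
Definition Ipow n := idmod (ideal_pow I n).

Lemma mem_idmod J a (x : M) : J a -> idmod J (mscale a x).
Proof.
move=> Ja; exists [:: (a, x)]; split=> [p [<-|]|] //=.
by rewrite maddr0.
Qed.

Lemma idmod_ind J (T : submod V) :
  (forall a x, J a -> T (mscale (M := M) a x)) -> forall x, idmod J x -> T x.
Proof.
move=> JT _ [l [lJ ->]]; elim: l lJ => [|p l IH] lJ; first exact: sm0.
apply: (@smD _ _ T); first by apply/JT/lJ; left.
by apply: IH => q ql; apply: lJ; right.
Qed.

(* The operators with index at least k are zero. *)
Definition varop (i : nat) (x : V) : V :=
  mscale (M := M) (if insub i is Some j then 'X_j else 0) x.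

Lemma varop_ord (i : 'I_k) x : varop i x = mscale (M := M) 'X_i x.
Proof. by rewrite /varop valK. Qed.

Lemma varop_linear i : is_linear (varop i).
Proof.
split=> [x y|a x]; first exact: (mscaleDr (m := M)).
by rewrite /varop /= !mscaleA mulrC.
Qed.

Lemma varopC i j x : varop i (varop j x) = varop j (varop i x).
Proof. by rewrite /varop !mscaleA mulrC. Qed.

(** I^(n+1) M is the sum of the x_i I^n M. As [T] is only an R-submodule, polynomial coefficients
    have to be absorbed into I^n M. *)
Lemma ideal_pow_ind n (T : submod V) :
  (forall i x, (i < k)%N -> Ipow n x -> T (varop i x)) ->
  forall x, Ipow n.+1 x -> T x.
Proof.
move=> XT; apply: idmod_ind => a x Ia; move: a Ia x.
apply: (@ideal_gen_ind _ _ (fun a => forall x : M, T (mscale a x))).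
- by move=> x; rewrite mscale0; apply: sm0.
- by move=> a b Ta Tb x; rewrite mscaleDl; apply: (@smD _ _ T _ _ (Ta x) (Tb x)).
move=> r _ [b [c [Ib Ic ->]]]; move: c Ic.
apply: (@ideal_gen_ind _ _ (fun c => forall x : M, T (mscale (r * (b * c)) x))).
- by move=> x; rewrite !mulr0 mscale0; apply: sm0.
- move=> c d Tc Td x; rewrite !mulrDr mscaleDl.
  exact: (@smD _ _ T _ _ (Tc x) (Td x)).
move=> q _ [i ->] x.
(* The coefficients r and q move next to the module element, and the variable acts last. *)
have -> : r * (b * (q * 'X_i)) = 'X_i * (b * (r * q)).
  by rewrite mulrCA [RHS]mulrCA ['X_i * _]mulrC -mulrA.
rewrite -mscaleA -varop_ord; apply: XT => //.
by rewrite -mscaleA; apply: mem_idmod.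
Qed.

Lemma Ipow_stable : gstable varop k Ipow.
Proof.
move=> i n x ik Px.
apply: (@idmod_ind _ (smpreim (varop_linear i) (Ipow n.+1))) Px => a y Ja.
rewrite smpreimE -[i]/(val (Ordinal ik)) varop_ord mscaleA mulrC.
apply: mem_idmod; rewrite -[_ * _]mul1r; apply: mem_ideal_gen.
exists a, 'X_(Ordinal ik); split=> //.
by rewrite -['X__]mul1r; apply: mem_ideal_gen; exists (Ordinal ik).
Qed.

Lemma Ipow0 x : Ipow 0 x.
Proof. by rewrite -[x](mscale1 (m := M)); apply: mem_idmod. Qed.

Lemma IpowS n x : Ipow n.+1 x -> Ipow n x.
Proof.
apply: ideal_pow_ind => i y ik; case: (ideal_mod_sub (ideal_pow I n) M) => _ _ hZ.
exact: hZ.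
Qed.

Lemma Ipow1 x : idmod I x -> Ipow 1 x.
Proof.
apply: idmod_ind => a y Ia; apply: mem_idmod.
by rewrite -[a]mul1r; apply: mem_ideal_gen; exists 1, a; rewrite mul1r.
Qed.

(** Since S = R + I, the generators of M over S already span M/IM over R. *)
Lemma Ipow0_acc : noetherian R -> fg_module M ->
  acc_between (Ipow 0) (Ipow 1).
Proof.
move=> noethR [gens genM] F QF Fmono FP.
pose T : submod V := @spanadd R V gens (Ipow 1).
suff topT x : T x.
  by apply: (@spanadd_acc _ noethR V gens (Ipow 1) F QF Fmono _) => j x _; apply: topT.
have [l [lg ->]] := genM x; elim: l lg => [|p l IH] lg; first exact: sm0.
apply: (@smD _ _ T); last by apply: IH => q ql; apply: lg; right.
have [c [t [It ->]]] := mpoly_const_add_vars p.1; rewrite mscaleDl.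
apply: (@smD _ _ T).
  by apply: (@smZ _ _ T c); apply: mem_spanadd; apply: lg; left.
by apply: spanadd_sub; apply: Ipow1; apply: mem_idmod.
Qed.

(** The associated graded module of the filtration is generated in degree 0, where its piece is
    M/IM. *)
Lemma Ipow_gacc : noetherian R -> fg_module M ->
  gacc varop k Ipow (fun n => Ipow n.+1).
Proof.
move=> noethR fgM.
apply: (@gacc_sub _ _ _ _ (gen varop_linear (Ipow 0) (fun n => Ipow n.+1) k)
  (fun n => Ipow n.+1)) => //; last first.
  apply: gacc_gen => //.
  - exact: varopC.
  - by move=> x _; apply: Ipow0.
  - exact: Ipow0_acc.
  - by move=> i n x; apply: Ipow_stable.
elim=> [|n IH] x //; apply: ideal_pow_ind => i y ik /IH.
exact: mem_sumim.
Qed.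

End PolynomialModule.

(** * From the graded pieces to the lengths c_n *)

Local Open Scope ereal_scope.

Theorem theorem8p1 (R : comNzRingType) (k : nat)
    (lam : module R -> \bar Rdefinitions.R) (M : module {mpoly R[k]}) :
  noetherian R ->
  is_length_function lam ->
  fg_module M ->
  lam (quotR M (ideal_vars R k)) < +oo ->
  (forall n : nat, lam (quotR M (ideal_pow (ideal_vars R k) n.+1)) < +oo) /\
  (exists q : {poly Rdefinitions.R}, (size q <= k.+1)%N /\
     exists N : nat, forall n : nat, (N <= n)%N ->
       lam (quotR M (ideal_pow (ideal_vars R k) n.+1)) = (q.[n%:R])%:E).
Proof.
move=> noethR lamP fgM fin0.
pose P := @Ipow R k M; pose top := smtop (restrict (mpolyC k (R := R)) M).
have lamE J : lam (quotR M J) = qlen lam top (idmod M J).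
  exact: (lam_quotient lamP (idmod M J)).
have PS n x : P n.+1 x -> P n x by apply: IpowS.
have topE : top = P 0%N.
  by apply: submod_ext => x; split=> // _; apply: Ipow0.
(* [ideal_pow] builds the first power as a product with the unit ideal; IM lies in the resulting
   submodule, so its quotient is no longer than M/IM. *)
have fin1 : qlen lam top (P 1%N) < +oo.
  move: fin0; rewrite lamE; apply: le_lt_trans.
  by have [] := @qlen_le _ _ _ lamP top _ (P 1%N) (@Ipow1 R k M) (fun _ _ => Logic.I).
(* The variables carry k copies of one graded piece onto the next, so finiteness propagates from
   degree 0. *)
have fin n : qlen lam (P n) (P n.+1) < +oo.
  elim: n => [|n IH]; first by rewrite -topE.
  have := @qlen_sumim _ _ _ (@varop_linear R k M) _ lamP k _ _ (P n.+2) (PS n).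
  move=> /(_ (fun i => @Ipow_stable _ _ _ i n.+1) IH); apply: le_lt_trans.
  have [] // := @qlen_le _ _ _ lamP
    (sumim (@varop_linear R k M) k (P n) (P n.+2)) (P n.+2) (P n.+1) (PS _).
  by apply: ideal_pow_ind => i x; apply: mem_sumim.
have lenS n : qlen lam top (P n.+2) =
    qlen lam (P n.+1) (P n.+2) + qlen lam top (P n.+1).
  by apply: qlen_add => // x; apply: PS.
have fint n : qlen lam top (P n.+1) < +oo.
  by elim: n => [//|n IH]; rewrite lenS; apply: lte_add_pinfty.
split=> [n|]; first by rewrite lamE; apply: fint.
have ev : evpoly k (fun n => fine (qlen lam (P n) (P n.+1))).
  apply: (hilbert_serre (X := @varop R k M)) => //.
  - exact: varop_linear.
  - exact: varopC.
  - exact: Ipow_stable.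
  - by move=> i n x; apply: Ipow_stable.
  - exact: Ipow_gacc.
(* The difference c_(n+1) - c_n is the length of the graded piece of degree n + 1, hence the shift;
   summation raises the size bound from k to k + 1. *)
have [n|q szq [N hq]] := evpoly_sum (h := fun n => fine (qlen lam top (P n.+1)))
    _ (evpoly_shift ev).
  by rewrite /= lenS fineD ?ge0_fin_numE ?(qlen_ge0 lamP) // addrC.
exists q; split=> //; exists N => n /hq <-.
by rewrite lamE (qlen_fineK lamP).
Qed.
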